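(* Let $0<a<1$ and let $b$ be an integer with $ab\ge1$. Let $I=[-1,1]$ and let $W:I\times I\to\mathbb{R}$ be the kernel $W(x,y)=\sum_{n=0}^{\infty}a^n\cos(b^n\pi(x-y))$. The reproducing kernel Hilbert space of real-valued functions on $I$ induced by $W$ is the space $$\mathcal{H}_W=\left\{f:I\to\mathbb{R}\;:\; f(x)=\sum_{n=0}^{\infty}a^{n/2}\left[c_n\cos(b^n\pi x)+d_n\sin(b^n\pi x)\right],\ x\in I,\ (c_n),(d_n)\in\ell^2\right\},$$ endowed with the inner product $$\langle f,g\rangle_W=\sum_{n=0}^{\infty}(c_ne_n+d_nf_n),\qquad f,g\in\mathcal{H}_W,$$ where $f(x)=\sum_{n=0}^{\infty}a^{n/2}[c_n\cos(b^n\pi x)+d_n\sin(b^n\pi x)]$ and $g(x)=\sum_{n=0}^{\infty}a^{n/2}[e_n\cos(b^n\pi x)+f_n\sin(b^n\pi x)]$ for $x\in I$.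
   Context: $\ell^2$ is the Hilbert space of square-summable real sequences indexed by $n\ge0$. The kernel $W$ is symmetric and positive definite (i.e. $\sum_{i,j}c_ic_jW(x_i,x_j)\ge0$ for all finite families of points $x_i$ and reals $c_i$). The reproducing kernel Hilbert space induced by $W$ is the unique Hilbert space $\mathcal{H}$ of real-valued functions on $I$ such that $W(x,\cdot)\in\mathcal{H}$ for all $x\in I$ and $f(x)=\langle f,W(x,\cdot)\rangle$ for all $f\in\mathcal{H}$ and $x\in I$. *)

(* Defs.v *)
From HB Require Import structures.
From mathcomp Require Import all_boot all_order all_algebra.
From mathcomp Require Import all_classical all_reals all_analysis.

Set Implicit Arguments.
Unset Strict Implicit.
Unset Printing Implicit Defensive.

Import Order.TTheory GRing.Theory Num.Theory.
Import numFieldNormedType.Exports.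

Local Open Scope classical_set_scope.
Local Open Scope ring_scope.

Section Rkhs.
Variables (R : realType) (X : Type).

(* In this section [ip] is a total function on pairs of functions, but only its
   values on the carrier [H] are meaningful. *)

Definition is_inner_product (H : set (X -> R))
    (ip : (X -> R) -> (X -> R) -> R) : Prop :=
  [/\ (forall f g, H f -> H g -> ip f g = ip g f),
      (forall (a : R) f g h, H f -> H g -> H h ->
         ip (a *: f + g) h = a * ip f h + ip g h),
      (forall f, H f -> 0 <= ip f f) &
      (forall f, H f -> ip f f = 0 -> f = 0)].

Definition ip_norm (ip : (X -> R) -> (X -> R) -> R) (f : X -> R) : R :=
  Num.sqrt (ip f f).

Definition ip_complete (H : set (X -> R))
    (ip : (X -> R) -> (X -> R) -> R) : Prop :=
  forall u : nat -> X -> R,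
    (forall n, H (u n)) ->
    (forall e : R, 0 < e -> exists N : nat, forall m n : nat,
       (N <= m)%N -> (N <= n)%N -> ip_norm ip (u m - u n) < e) ->
    exists2 f, H f & ip_norm ip (u n - f) @[n --> \oo] --> (0 : R).

Definition hilbert_function_space (H : set (X -> R))
    (ip : (X -> R) -> (X -> R) -> R) : Prop :=
  [/\ H 0,
      (forall (a : R) f g, H f -> H g -> H (a *: f + g)),
      is_inner_product H ip &
      ip_complete H ip].

Definition positive_definite_kernel (W : X -> X -> R) : Prop :=
  (forall x y, W x y = W y x) /\
  (forall (n : nat) (x : 'I_n -> X) (c : 'I_n -> R),
     0 <= \sum_(i < n) \sum_(j < n) c i * c j * W (x i) (x j)).

Definition reproduces (W : X -> X -> R) (H : set (X -> R))
    (ip : (X -> R) -> (X -> R) -> R) : Prop :=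
  (forall x, H (W x)) /\ (forall f x, H f -> f x = ip f (W x)).

(* The clauses say that W is a kernel, that (H, ip) is a Hilbert space of
   functions reproduced by W, and that it is the only one. *)
Definition is_rkhs_induced_by (W : X -> X -> R) (H : set (X -> R))
    (ip : (X -> R) -> (X -> R) -> R) : Prop :=
  [/\ positive_definite_kernel W,
      hilbert_function_space H ip /\ reproduces W H ip &
      forall H' ip', hilbert_function_space H' ip' -> reproduces W H' ip' ->
        H' = H /\ (forall f g, H f -> H g -> ip' f g = ip f g)].

End Rkhs.

Section WeierstrassSpace.
Variable R : realType.

Definition sym_itv : Type := {x : R | -1 <= x <= 1}.

Definition square_summable (c : R^nat) : Prop :=
  cvgn (series (fun n => c n ^+ 2)).

Variables (a : R) (b : int).

Definition weierstrass_kernel (x y : sym_itv) : R :=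
  limn (series (fun n => a ^+ n * cos (b%:~R ^+ n * pi * (val x - val y)))).

(* f is the pointwise sum on [-1, 1] of the trigonometric series with
   square-summable coefficients (c_n), (d_n). *)
Definition has_expansion (f : sym_itv -> R) (c d : R^nat) : Prop :=
  [/\ square_summable c, square_summable d &
      forall x : sym_itv,
        series (fun n => a `^ (n%:R / 2) *
                  (c n * cos (b%:~R ^+ n * pi * val x) +
                   d n * sin (b%:~R ^+ n * pi * val x))) @ \oo --> f x].

Definition weierstrass_space : set (sym_itv -> R) :=
  [set f | exists c d, has_expansion f c d].

(* The value does not depend on the chosen expansions of f and g. *)
Definition is_weierstrass_ip
    (ip : (sym_itv -> R) -> (sym_itv -> R) -> R) : Prop :=
  forall (f g : sym_itv -> R) (c d e h : R^nat),
    has_expansion f c d -> has_expansion g e h ->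
    series (fun n => c n * e n + d n * h n) @ \oo --> ip f g.

End WeierstrassSpace.

(* Main.v *)
(* The coefficients (c_n), (d_n) of a vanishing expansion are zero: if those of
   index below m are, then at two points at distance 2/b^(m+1) all terms of index
   above m agree by periodicity, so the m-th terms agree as well; as b > 1, two
   such pairs of points force c_m = d_m = 0. Hence the space is isometric to
   l^2 x l^2, and W(x, .) has coefficients a^(n/2) cos(b^n pi x) and
   a^(n/2) sin(b^n pi x), which gives the reproducing property. A Hilbert space
   reproduced by W is determined by W because the span of the W(x, .) is dense
   in it and carries the inner product prescribed by W. *)
Require Import Defs.
From HB Require Import structures.
From mathcomp Require Import all_boot all_order all_algebra.
From mathcomp Require Import all_classical all_reals all_analysis.
From mathcomp Require Import ring lra.

Set Implicit Arguments.
Unset Strict Implicit.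
Unset Printing Implicit Defensive.

Import Order.TTheory GRing.Theory Num.Theory.
Import numFieldNormedType.Exports.

Local Open Scope classical_set_scope.
Local Open Scope ring_scope.

(** For [A > 0], evaluate at the minimizer [- B / A]; for [A = 0], an affine function bounded below
    is constant, so [B = 0]. *)
Lemma quadratic_ge0_discr_le {R : realFieldType} (A B C : R) : 0 <= A ->
  (forall t, 0 <= t ^+ 2 * A + 2 * t * B + C) -> B ^+ 2 <= A * C.
Proof.
move=> A0 h.
have [A1|A1] := eqVneq A 0.
  rewrite A1 mul0r.
  have [->|B0] := eqVneq B 0; first by rewrite expr0n.
  (* At this [t] the affine function would take the value -1. *)
  have := h (- (C + 1) / (2 * B)).
  rewrite A1 mulr0 add0r.
  have C0 := h 0; rewrite !(expr0n, mulr0, mul0r, add0r) /= in C0.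
  have -> : 2 * (- (C + 1) / (2 * B)) * B = - (C + 1) by field.
  lra.
have {}A0 : 0 < A by rewrite lt_neqAle eq_sym A1.
have := h (- B / A).
have -> : (- B / A) ^+ 2 * A + 2 * (- B / A) * B + C = (A * C - B ^+ 2) / A.
  by field.
by rewrite pmulr_lge0 ?invr_gt0// subr_ge0.
Qed.

(** * Hilbert spaces of functions: bilinearity and Cauchy-Schwarz *)

Section HilbertFunctionSpace.
Context {R : realType} {X : Type} {H : set (X -> R)}
  {ip : (X -> R) -> (X -> R) -> R}.
Hypothesis hH : hilbert_function_space H ip.

Lemma hfs_lin (t : R) f g : H f -> H g -> H (t *: f + g).
Proof. by case: hH => _ + _ _; apply. Qed.

Lemma hfs0 : H 0.
Proof. by case: hH. Qed.

Lemma hfsB f g : H f -> H g -> H (f - g).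
Proof.
by move=> Hf Hg; rewrite addrC -scaleN1r; exact: hfs_lin.
Qed.

Lemma ipC f g : H f -> H g -> ip f g = ip g f.
Proof. by case: hH => _ _ [+ _ _ _] _; apply. Qed.

Lemma ip_linl (t : R) f g h : H f -> H g -> H h ->
  ip (t *: f + g) h = t * ip f h + ip g h.
Proof. by case: hH => _ _ [_ + _ _] _; apply. Qed.

Lemma ip_linr (t : R) f g h : H f -> H g -> H h ->
  ip h (t *: f + g) = t * ip h f + ip h g.
Proof.
move=> Hf Hg Hh; by rewrite ipC ?ip_linl ?(ipC Hh)//; exact: hfs_lin.
Qed.

Lemma ip_ge0 f : H f -> 0 <= ip f f.
Proof. by case: hH => _ _ [_ _ + _] _; apply. Qed.

Lemma ip0l f : H f -> ip 0 f = 0.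
Proof.
move=> Hf; have := ip_linl 1 hfs0 hfs0 Hf.
by rewrite scaler0 addr0 mul1r => /eqP; rewrite -subr_eq subrr eq_sym => /eqP.
Qed.

Lemma ip0r f : H f -> ip f 0 = 0.
Proof. by move=> Hf; rewrite ipC ?ip0l//; exact: hfs0. Qed.

Lemma ipBr f g h : H f -> H g -> H h -> ip h (f - g) = ip h f - ip h g.
Proof.
by move=> Hf Hg Hh; rewrite addrC -scaleN1r ip_linr// mulN1r addrC.
Qed.

Lemma ip_sq_lin (t : R) f g : H f -> H g ->
  ip (t *: f + g) (t *: f + g) = t ^+ 2 * ip f f + 2 * t * ip f g + ip g g.
Proof.
move=> Hf Hg; have Hfg := hfs_lin t Hf Hg.
by rewrite ip_linl// !ip_linr// (ipC Hg)//; ring.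
Qed.

Lemma ip_sqB f g : H f -> H g ->
  ip (f - g) (f - g) = ip f f - 2 * ip f g + ip g g.
Proof.
by move=> Hf Hg; rewrite addrC -scaleN1r ip_sq_lin// (ipC Hg)//; ring.
Qed.

(** Completeness in terms of squared norms, which keeps square roots out of the approximation
    arguments. *)
Lemma ip_complete_sq (u : nat -> X -> R) : (forall n, H (u n)) ->
  (forall e : R, 0 < e -> exists N : nat, forall m n : nat,
     (N <= m)%N -> (N <= n)%N -> ip (u m - u n) (u m - u n) < e) ->
  exists2 f, H f & ip (u n - f) (u n - f) @[n --> \oo] --> (0 : R).
Proof.
move=> Hu uC; case: hH => _ _ _ /(_ u Hu)[e e0|f Hf uf].
  have [N NP] := uC (e ^+ 2) (exprn_gt0 2 e0); exists N => m n Nm Nn.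
  by rewrite -(ger0_norm (ltW e0)) -sqrtr_sqr ltr_sqrt ?exprn_gt0//; exact: NP.
exists f => //; rewrite -[0](mulr0 0).
under eq_fun => n do rewrite -(sqr_sqrtr (ip_ge0 (hfsB (Hu n) Hf))).
exact: (cvgM uf uf).
Qed.

Lemma ip_cauchy_schwarz f g : H f -> H g -> ip f g ^+ 2 <= ip f f * ip g g.
Proof.
move=> Hf Hg; apply: quadratic_ge0_discr_le => [|t].
  exact: ip_ge0.
by rewrite -ip_sq_lin//; apply: ip_ge0; exact: hfs_lin.
Qed.
End HilbertFunctionSpace.

Lemma cvg_sqr_dist {R : realType} {u v : R^nat} {l : R} :
  (forall n, (u n - l) ^+ 2 <= v n) -> v @ \oo --> (0 : R) -> u @ \oo --> l.
Proof.
move=> uv v0; apply/cvgrPdist_lt => e e0.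
move/cvgrPdist_lt: v0 => /(_ _ (exprn_gt0 2 e0)); apply: filterS => n.
rewrite sub0r normrN => vn; rewrite distrC.
rewrite -(ltr_pXn2r (n := 2))// ?nnegrE// ?ltW//.
rewrite real_normK ?num_real// (le_lt_trans _ vn)// (le_trans (uv n))//.
exact: ler_norm.
Qed.

(** * Density of the span of the kernel sections *)

(** The constructors mirror the closure clauses of a Hilbert function space, so linear facts follow
    by induction, without finite sums. *)
Inductive kernel_span {R : realType} {X : Type} (W : X -> X -> R) :
    (X -> R) -> Prop :=
| kernel_span0 : kernel_span W 0
| kernel_span_ker x : kernel_span W (W x)
| kernel_span_lin (t : R) f g :
    kernel_span W f -> kernel_span W g -> kernel_span W (t *: f + g).

Section Reproducing.
Context {R : realType} {X : Type} {W : X -> X -> R} {H : set (X -> R)}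
  {ip : (X -> R) -> (X -> R) -> R}.
Hypotheses (hH : hilbert_function_space H ip) (hW : reproduces W H ip).

Lemma kernel_span_sub f : kernel_span W f -> H f.
Proof.
elim=> [|x|t g h _ Hg _ Hh]; first exact: (hfs0 hH).
- by case: hW => + _; apply.
- exact: (hfs_lin hH).
Qed.

Lemma reproducesE f x : H f -> f x = ip f (W x).
Proof. by case: hW => _; apply. Qed.

(** Completeness gives a norm limit, and by the reproducing property and Cauchy-Schwarz norm
    convergence implies pointwise convergence, so this limit is [f]. Pointwise limits do not mention
    [ip], which lets [f] be carried to another space. *)
Lemma kernel_span_cvg (u : nat -> X -> R) f :
  (forall n, kernel_span W (u n)) ->
  (forall e : R, 0 < e -> exists N : nat, forall m n : nat,
     (N <= m)%N -> (N <= n)%N -> ip (u m - u n) (u m - u n) < e) ->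
  (forall x, u n x @[n --> \oo] --> f x) ->
  H f /\ ip (u n - f) (u n - f) @[n --> \oo] --> (0 : R).
Proof.
move=> uW uC uf; have Hu n : H (u n) by exact: kernel_span_sub.
have [g Hg ug] := ip_complete_sq hH Hu uC.
suff -> : f = g by [].
apply/funext => x; apply: (cvg_unique _ (uf x)) => //.
have HWx := kernel_span_sub (kernel_span_ker W x).
apply: (@cvg_sqr_dist _ _
  (fun n => ip (u n - g) (u n - g) * ip (W x) (W x))) => [n|]; last first.
  by rewrite -(mul0r (ip (W x) (W x))); exact: cvgMr_tmp.
have Hug := hfsB hH (Hu n) Hg.
have -> : u n x - g x = ip (u n - g) (W x) by rewrite -reproducesE.
exact: (ip_cauchy_schwarz hH).
Qed.

(* The [u n] are a minimizing sequence for the distance from [f] to the span. By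
   the parallelogram identity it is Cauchy, and by the variational inequality
   [f - u n] is asymptotically orthogonal to each [W x], that is,
   [u n x --> f x]. *)
Lemma kernel_span_approx f : H f -> exists u : nat -> X -> R,
  [/\ (forall n, kernel_span W (u n)),
      (forall e : R, 0 < e -> exists N : nat, forall m n : nat,
         (N <= m)%N -> (N <= n)%N -> ip (u m - u n) (u m - u n) < e) &
      (forall x, u n x @[n --> \oo] --> f x)].
Proof.
move=> Hf; pose D := [set ip (f - k) (f - k) | k in kernel_span W].
have HfB k : kernel_span W k -> H (f - k).
  by move=> /kernel_span_sub; exact: (hfsB hH).
have Dlb : lbound D 0 by move=> _ [k kW <-]; exact/(ip_ge0 hH)/HfB.
have Dinf : has_inf D.
  split; last by exists 0.
  by exists (ip (f - 0) (f - 0)), 0; first exact: kernel_span0.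
have dk k : kernel_span W k -> inf D <= ip (f - k) (f - k).
  by move=> kW; apply: ge_inf; [exists 0|exists k].
have /choice[u uP] : forall n, exists k, kernel_span W k /\
    ip (f - k) (f - k) < inf D + harmonic n.
  move=> n; have n0 : 0 < harmonic n :> R by rewrite /harmonic/= invr_gt0.
  by have [_ [k kW <-] kn] := inf_adherent n0 Dinf; exists k.
have uW n : kernel_span W (u n) by case: (uP n).
exists u; split => // [e e0|x].
  (* The parallelogram identity will bound the squared distance by
     [2 * harmonic m + 2 * harmonic n]. *)
  have e4 : 0 < e / 4 by rewrite divr_gt0.
  have [N _ NP'] := near_infty_natSinv_lt (PosNum e4).
  have NP n : (N <= n)%N -> harmonic n < e / 4 by move=> Nn; exact: NP'.
  exists N => m n Nm Nn.
  have mP := NP m Nm; have nP := NP n Nn.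
  have [_ um] := uP m; have [_ un] := uP n.
  pose p : X -> R := f - u m; pose q : X -> R := f - u n.
  have Hp : H p by exact: HfB.
  have Hq : H q by exact: HfB.
  have -> : u m - u n = q - p by apply/funext => y; rewrite /p/q !fctE; ring.
  (* The trailing 0 puts the midpoint in the shape of [kernel_span_lin] applied twice. *)
  pose mid := 2^-1 *: u m + (2^-1 *: u n + 0).
  have midW : kernel_span W mid.
    by do 2 (apply: kernel_span_lin => //); exact: kernel_span0.
  have pq : 1 *: p + q = 2 *: (f - mid) + 0.
    rewrite /p /q /mid !addr0; apply/funext => y.
    by rewrite !fctE /GRing.scale/=; field.
  have := dk _ midW; have := ip_sq_lin hH 1 Hp Hq.
  rewrite pq (ip_sq_lin hH)//; [|exact: HfB|exact: (hfs0 hH)].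
  rewrite (ip_sqB hH Hq Hp) (ipC hH Hq Hp) (ip0r hH) ?(ip0l hH)//;
    try exact: HfB.
  + rewrite -/p in um; rewrite -/q in un.
    lra.
  + exact: (hfs0 hH).
have HWx := kernel_span_sub (kernel_span_ker W x).
apply: (@cvg_sqr_dist _ _ (fun n => ip (W x) (W x) * harmonic n)) => [n|].
  have [_ un] := uP n; have Hfu := HfB _ (uW n).
  have -> : u n x - f x = - ip (W x) (f - u n).
    by rewrite (ipC hH)// -reproducesE// !fctE; ring.
  rewrite sqrrN; apply: quadratic_ge0_discr_le; first exact: (ip_ge0 hH).
  (* Moving [u n] along [W x] cannot bring the squared distance below [inf D], which [u n] attains
     up to [harmonic n]; hence the quadratic in [t] with constant term [harmonic n] is
     nonnegative. *)
  move=> t; have tW := kernel_span_lin (- t) (kernel_span_ker W x) (uW n).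
  have := dk _ tW.
  have -> : f - (- t *: W x + u n) = t *: W x + (f - u n).
    by apply/funext => y; rewrite !fctE /GRing.scale/=; ring.
  by rewrite (ip_sq_lin hH)//; lra.
rewrite -(mulr0 (ip (W x) (W x))); apply: cvgMl_tmp.
exact: cvg_harmonic.
Qed.

End Reproducing.

(** * Uniqueness of the space reproduced by a kernel *)

Section Uniqueness.
Context {R : realType} {X : Type} {W : X -> X -> R} {H H' : set (X -> R)}
  {ip ip' : (X -> R) -> (X -> R) -> R}.
Hypotheses (hH : hilbert_function_space H ip) (hW : reproduces W H ip).
Hypotheses (hH' : hilbert_function_space H' ip') (hW' : reproduces W H' ip').

(** Against [W x], both inner products return [f x]; linearity does the rest. *)
Lemma ip_kernel_span_eq f g : H f -> H' f -> kernel_span W g ->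
  ip f g = ip' f g.
Proof.
move=> Hf Hf'; elim=> [|x|t h k hk IHh kk IHk].
- by rewrite (ip0r hH)// (ip0r hH').
- by rewrite -(reproducesE hW)// -(reproducesE hW').
have s := kernel_span_sub hH hW; have s' := kernel_span_sub hH' hW'.
by rewrite (ip_linr hH) ?(ip_linr hH') ?IHh ?IHk//; auto.
Qed.

(** The two inner products agree on the span, so approximants that are Cauchy for [ip] are Cauchy
    for [ip'], and their common pointwise limit [f] lies in both spaces. *)
Lemma rkhs_transfer f : H f -> exists u : nat -> X -> R,
  [/\ (forall n, kernel_span W (u n)), H' f,
      ip (u n - f) (u n - f) @[n --> \oo] --> (0 : R) &
      ip' (u n - f) (u n - f) @[n --> \oo] --> (0 : R)].
Proof.
move=> Hf; have [u [uW uC uf]] := kernel_span_approx hH hW Hf.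
have [_ uip] := kernel_span_cvg hH hW uW uC uf.
have [|Hf' uip'] := kernel_span_cvg hH' hW' uW _ uf; last by exists u.
move=> e /uC[N NP]; exists N => m n Nm Nn.
have umn : kernel_span W (u m - u n).
  by rewrite addrC -scaleN1r; exact: kernel_span_lin.
by rewrite -(ip_kernel_span_eq (kernel_span_sub hH hW umn)
  (kernel_span_sub hH' hW' umn) umn) NP.
Qed.

End Uniqueness.

Lemma ip_cvgr {R : realType} {X : Type} {H : set (X -> R)}
    {ip : (X -> R) -> (X -> R) -> R} {u : nat -> X -> R} {f g : X -> R} :
  hilbert_function_space H ip -> (forall n, H (u n)) -> H f -> H g ->
  ip (u n - g) (u n - g) @[n --> \oo] --> (0 : R) ->
  ip f (u n) @[n --> \oo] --> ip f g.
Proof.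
move=> hH Hu Hf Hg ug.
apply: (@cvg_sqr_dist _ _ (fun n => ip f f * ip (u n - g) (u n - g))) => [n|].
  have Hug := hfsB hH (Hu n) Hg.
  by rewrite -(ipBr hH)//; exact: (ip_cauchy_schwarz hH).
by rewrite -(mulr0 (ip f f)); exact: cvgMl_tmp.
Qed.

Lemma rkhs_unique {R : realType} {X : Type} (W : X -> X -> R)
    (H H' : set (X -> R)) (ip ip' : (X -> R) -> (X -> R) -> R) :
  hilbert_function_space H ip -> reproduces W H ip ->
  hilbert_function_space H' ip' -> reproduces W H' ip' ->
  H' = H /\ (forall f g, H f -> H g -> ip' f g = ip f g).
Proof.
move=> hH hW hH' hW'.
have HH' f : H f -> H' f by case/(rkhs_transfer hH hW hH' hW') => ? [].
have H'H f : H' f -> H f by case/(rkhs_transfer hH' hW' hH hW) => ? [].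
split=> [|f g Hf Hg]; first by apply/seteqP; split.
(* Only [g] is approximated: the inner products of [f] with the span already agree, and both sides
   pass to the limit. *)
have [u [uW _ ug ug']] := rkhs_transfer hH hW hH' hW' Hg.
have Hu n := kernel_span_sub hH hW (uW n).
have := ip_cvgr hH Hu Hf Hg ug.
under eq_fun => n do
  rewrite (ip_kernel_span_eq hH hW hH' hW' Hf (HH' _ Hf) (uW n)).
apply: cvg_unique => //.
exact: (ip_cvgr hH' (fun n => HH' _ (Hu n)) (HH' _ Hf) (HH' _ Hg)).
Qed.

(** Since [W x y] is the inner product of [W x] and [W y], the double sum is the squared norm of the
    combination of the [W (x i)] with coefficients [c i]. *)
Lemma reproduces_positive_definite {R : realType} {X : Type} (W : X -> X -> R)
    (H : set (X -> R)) (ip : (X -> R) -> (X -> R) -> R) :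
  hilbert_function_space H ip -> reproduces W H ip ->
  positive_definite_kernel W.
Proof.
move=> hH hW; have HW x : H (W x) by case: hW.
split=> [x y|n x c].
  by rewrite (reproducesE hW _ (HW x)) (ipC hH)// -(reproducesE hW).
have HS m (g : 'I_m -> X) (e : 'I_m -> R) : H (\sum_(i < m) e i *: W (g i)).
  by elim/big_rec: _ => [|i f _ Hf]; [exact: (hfs0 hH)|exact: (hfs_lin hH)].
have ipS h (g : 'I_n -> X) (e : 'I_n -> R) : H h ->
    ip (\sum_(i < n) e i *: W (g i)) h = \sum_(i < n) e i * ip (W (g i)) h.
  move=> Hh; suff [] : H (\sum_(i < n) e i *: W (g i)) /\
    ip (\sum_(i < n) e i *: W (g i)) h =
      \sum_(i < n) e i * ip (W (g i)) h by [].
  (* Membership in [H] is carried along because [ip] is linear only on [H]. *)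
  apply: (big_rec2 (fun f r => H f /\ ip f h = r)) => [|i r f _ [Hf <-]].
    by split; [exact: (hfs0 hH)|rewrite (ip0l hH)].
  by split; [exact: (hfs_lin hH)|rewrite (ip_linl hH)].
have := ip_ge0 hH (HS n x c); rewrite ipS//.
under eq_bigr => i _ do rewrite (ipC hH (HW _) (HS n x c)) ipS// mulr_sumr.
congr (0 <= _); apply: eq_bigr => i _; apply: eq_bigr => j _.
by rewrite mulrA (ipC hH)// -(reproducesE hW).
Qed.

(** * Square-summable sequences and completeness of l^2 *)

Section SquareSummable.
Context {R : realType}.
Implicit Types c d e : R^nat.

Lemma cvg_series_lin (k l m : R) (u v : R^nat) :
  series u @ \oo --> l -> series v @ \oo --> m ->
  series (fun n => k * u n + v n) @ \oo --> k * l + m.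
Proof.
move=> ul vm.
have -> : series (fun n => k * u n + v n) =
    (fun n => k * series u n + series v n).
  by apply/funext => n; rewrite !seriesEnat /= big_split -mulr_sumr.
by apply: cvgD => //; exact: cvgMl_tmp.
Qed.

Lemma series_ge0_le_lim (u : R^nat) (l : R) n : (forall k, 0 <= u k) ->
  series u @ \oo --> l -> series u n <= l.
Proof.
move=> u0 ul; rewrite -(cvg_lim _ ul)//; apply: nondecreasing_cvgn_le.
  by rewrite seriesEnat; apply: nondecreasing_series.
by apply/cvg_ex; exists l.
Qed.

Lemma square_summable_bounded (M : R) c :
  (forall n, series (fun k => c k ^+ 2) n <= M) -> square_summable c.
Proof.
move=> cM; apply: nondecreasing_is_cvgn.
  by rewrite seriesEnat; apply: nondecreasing_series => k _ _; exact: sqr_ge0.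
by exists M => _ [n _ <-].
Qed.

Lemma square_summable_lin (k : R) c d : square_summable c ->
  square_summable d -> square_summable (fun n => k * c n + d n).
Proof.
move=> /cvg_ex[/= l cl] /cvg_ex[/= m dm]; rewrite /square_summable.
(* The majorant is [2 k^2 c^2 + 2 d^2], split so that [cvg_series_lin] applies twice. *)
apply: (@series_le_cvg _ _ (fun n =>
  2 * k ^+ 2 * c n ^+ 2 + (1 * d n ^+ 2 + d n ^+ 2))).
- by move=> n; exact: sqr_ge0.
- by move=> n; have := sqr_ge0 (k * c n); have := sqr_ge0 (d n); nra.
- by move=> n; have := sqr_ge0 (k * c n - d n); nra.
apply/cvg_ex; exists (2 * k ^+ 2 * l + (1 * m + m)).
by do 2 (apply: cvg_series_lin => //).
Qed.

Lemma square_summable_mul c d : square_summable c -> square_summable d ->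
  cvgn (series (fun n => c n * d n)).
Proof.
move=> /cvg_ex[/= l cl] /cvg_ex[/= m dm]; apply: normed_cvg.
apply: (@series_le_cvg _ _ (fun n => 1 * c n ^+ 2 + d n ^+ 2)).
- by move=> n; exact: normr_ge0.
- by move=> n; rewrite mul1r addr_ge0 ?sqr_ge0.
- move=> n /=; rewrite ler_norml; have := sqr_ge0 (c n + d n).
  have := sqr_ge0 (c n - d n); have := sqr_ge0 (c n); have := sqr_ge0 (d n).
  by move=> *; apply/andP; split; nra.
by apply/cvg_ex; exists (1 * l + m); exact: cvg_series_lin.
Qed.

(** Coordinates converge by completeness of the reals; for fixed [K] the partial sum is finite, so
    its bound survives the limit in [n]. Bounds uniform in [K] stand in for the l^2 norm. *)
Lemma square_summable_complete (s : nat -> R^nat) :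
  (forall e : R, 0 < e -> exists N, forall m n, (N <= m)%N -> (N <= n)%N ->
     forall K, series (fun k => (s m k - s n k) ^+ 2) K <= e) ->
  exists t : R^nat, forall e : R, 0 < e -> exists N, forall m, (N <= m)%N ->
     forall K, series (fun k => (s m k - t k) ^+ 2) K <= e.
Proof.
move=> sC.
have scvg k : cvgn (s ^~ k).
  apply: R_complete; apply: cauchy_exP => e e0.
  (* Halving turns the non-strict bound on partial sums into the strict one of a ball. *)
  have [N NP] := sC (e ^+ 2 / 2) (divr_gt0 (exprn_gt0 2 e0) (ltr0Sn _ 1)).
  exists (s N k); exists N => // n /= Nn.
  rewrite -ball_normE /= -(ltr_pXn2r (n := 2))// ?nnegrE ?ltW//.
  rewrite real_normK ?num_real//; have := NP N n (leqnn N) Nn k.+1.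
  rewrite seriesEnat /= big_nat_recr//=.
  have : 0 <= \sum_(0 <= i < k) (s N i - s n i) ^+ 2.
    by apply: sumr_ge0 => i _; exact: sqr_ge0.
  have := exprn_gt0 2 e0; lra.
exists (fun k => limn (s ^~ k)) => e e0; have [N NP] := sC e e0.
exists N => m Nm K.
have sK : series (fun k => (s m k - s n k) ^+ 2) K @[n --> \oo] -->
    series (fun k => (s m k - limn (s ^~ k)) ^+ 2) K.
  rewrite !seriesEnat /=; apply: cvg_big => [|k _]; first exact: add_continuous.
  by apply: cvgM; apply: cvgB => //; exact: cvg_cst.
apply: (cvgr_to_le sK); exists N => // n /= Nn; exact: NP.
Qed.

End SquareSummable.

(** * Trigonometric expansions and uniqueness of their coefficients *)

Section WeierstrassExpansions.
Context {R : realType} {a : R} {b : int}.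
Hypotheses (a0 : 0 < a) (a1 : a < 1).
Implicit Types (f g : sym_itv R -> R) (c d e h : R^nat).

Lemma powR_half_sqr n : (a `^ (n%:R / 2)) ^+ 2 = a ^+ n.
Proof.
by rewrite -powR_mulrn ?powR_ge0// -powRrM divfK ?powR_mulrn ?ltW.
Qed.

Lemma square_summable_powR_half (t : R^nat) : (forall n, `|t n| <= 1) ->
  square_summable (fun n => a `^ (n%:R / 2) * t n).
Proof.
move=> t1; apply: (@series_le_cvg _ _ (geometric 1 a)).
- by move=> n; exact: sqr_ge0.
- by move=> n; rewrite /= mul1r exprn_ge0// ltW.
- move=> n; rewrite /= mul1r exprMn powR_half_sqr.
  apply: ler_piMr; first by rewrite exprn_ge0// ltW.
  by rewrite -real_normK ?num_real// exprn_ile1.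
by apply: is_cvg_geometric_series; rewrite ger0_norm// ltW.
Qed.

Lemma norm_cos_le1 (x : R) : `|cos x| <= 1.
Proof. by rewrite ler_norml cos_geN1 cos_le1. Qed.

Lemma norm_sin_le1 (x : R) : `|sin x| <= 1.
Proof. by rewrite ler_norml sin_geN1 sin_le1. Qed.

(** With [sin_coef], these are both the weighted trigonometric functions evaluated at [x] and the
    coefficients of the kernel section at [x]; an expansion at [x] is thus an l^2 pairing with
    them. *)
Definition cos_coef (x : sym_itv R) : R^nat :=
  fun n => a `^ (n%:R / 2) * cos (b%:~R ^+ n * pi * val x).

Definition sin_coef (x : sym_itv R) : R^nat :=
  fun n => a `^ (n%:R / 2) * sin (b%:~R ^+ n * pi * val x).

Lemma has_expansion_series f c d : has_expansion a b f c d <->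
  [/\ square_summable c, square_summable d & forall x,
    series (fun n => c n * cos_coef x n + d n * sin_coef x n) @ \oo --> f x].
Proof.
have E x : (fun n => a `^ (n%:R / 2) * (c n * cos (b%:~R ^+ n * pi * val x) +
    d n * sin (b%:~R ^+ n * pi * val x))) =
    (fun n => c n * cos_coef x n + d n * sin_coef x n).
  by apply/funext => n; rewrite /cos_coef /sin_coef; ring.
by split=> -[c2 d2 cd]; split=> // x; have := cd x; rewrite E.
Qed.

Lemma cvg_series_mul2 c d e h : square_summable c -> square_summable d ->
  square_summable e -> square_summable h ->
  cvgn (series (fun n => c n * e n + d n * h n)).
Proof.
move=> c2 d2 e2 h2; have /cvg_ex[/= l ce] := square_summable_mul c2 e2.
have /cvg_ex[/= m dh] := square_summable_mul d2 h2.
apply/cvg_ex; exists (1 * l + m).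
have := cvg_series_lin (k := 1) ce dh.
by under eq_fun => n do rewrite mul1r.
Qed.

Lemma square_summable_cos_coef x : square_summable (cos_coef x).
Proof. by apply: square_summable_powR_half => n; exact: norm_cos_le1. Qed.

Lemma square_summable_sin_coef x : square_summable (sin_coef x).
Proof. by apply: square_summable_powR_half => n; exact: norm_sin_le1. Qed.

Lemma has_expansion_ex c d : square_summable c -> square_summable d ->
  exists f, has_expansion a b f c d.
Proof.
move=> c2 d2.
exists (fun x => limn (series (fun n =>
  c n * cos_coef x n + d n * sin_coef x n))).
apply/has_expansion_series; split=> // x; apply: cvg_series_mul2 => //.
  exact: square_summable_cos_coef.
exact: square_summable_sin_coef.
Qed.

Lemma has_expansion_lin (k : R) f g c d e h :
  has_expansion a b f c d -> has_expansion a b g e h ->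
  has_expansion a b (k *: f + g)
    (fun n => k * c n + e n) (fun n => k * d n + h n).
Proof.
move=> /has_expansion_series[c2 d2 fE] /has_expansion_series[e2 h2 gE].
apply/has_expansion_series; split; [exact: square_summable_lin..|move=> x].
have := cvg_series_lin (k := k) (fE x) (gE x).
rewrite (_ : (fun n => k * _ + _) = fun n => (k * c n + e n) * cos_coef x n +
    (k * d n + h n) * sin_coef x n)//.
by apply/funext => n; ring.
Qed.

Lemma has_expansionB f g c d e h :
  has_expansion a b f c d -> has_expansion a b g e h ->
  has_expansion a b (f - g) (fun n => c n - e n) (fun n => d n - h n).
Proof.
move=> fE gE; have := has_expansion_lin (-1) gE fE; rewrite scaleN1r addrC.
have E (u v : R^nat) : (fun n => -1 * u n + v n) = (fun n => v n - u n).
  by apply/funext => n; ring.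
by rewrite !E.
Qed.

Lemma has_expansion0 : has_expansion a b 0 (fun=> 0) (fun=> 0).
Proof.
have s0 : square_summable (fun=> 0 : R).
  apply: (@square_summable_bounded _ 0) => n.
  by rewrite seriesEnat /= big1// => i _; rewrite expr0n.
apply/has_expansion_series; split=> // x.
apply: cvg_near_cst; near=> n.
by rewrite seriesEnat /= big1// => i _; rewrite !mul0r addr0.
Unshelve. all: by end_near. Qed.

(** The addition formula for [cos (u - v)], with [a ^+ n] split into two factors [a^(n/2)]. *)
Lemma has_expansion_kernel x :
  has_expansion a b (weierstrass_kernel a b x) (cos_coef x) (sin_coef x).
Proof.
have cc z : square_summable (cos_coef z) by exact: square_summable_cos_coef.
have ss z : square_summable (sin_coef z) by exact: square_summable_sin_coef.
apply/has_expansion_series; split => // y.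
have E : (fun n => a ^+ n * cos (b%:~R ^+ n * pi * (val x - val y))) =
    (fun n => cos_coef x n * cos_coef y n + sin_coef x n * sin_coef y n).
  apply/funext => n; rewrite mulrBr cosB -powR_half_sqr /cos_coef /sin_coef.
  by ring.
by rewrite /weierstrass_kernel E; exact: cvg_series_mul2.
Qed.

Hypothesis b1 : 1 < b.

(** The difference of the partial sums at [x] and [y] tends to 0, yet beyond index [m] it is
    constantly the difference of the [m]-th terms. *)
Lemma has_expansion0_term_eq c d m (x y : sym_itv R) :
  has_expansion a b 0 c d ->
  (forall i, (i < m)%N -> c i = 0 /\ d i = 0) ->
  val x = val y + 2 / b%:~R ^+ m.+1 ->
  c m * cos_coef x m + d m * sin_coef x m =
  c m * cos_coef y m + d m * sin_coef y m.
Proof.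
move=> /has_expansion_series[_ _ E] cd0 xy.
pose w z n := c n * cos_coef z n + d n * sin_coef z n.
apply/eqP; rewrite -subr_eq0; apply/eqP; rewrite -/(w x m) -/(w y m).
have w0 : series (w x) n - series (w y) n @[n --> \oo] --> (0 : R).
  by rewrite -(subrr (0 : R)); apply: cvgB; exact: E.
apply: (cvg_unique _ _ w0) => //; apply: cvg_near_cst.
exists m.+1 => // n /= mn.
rewrite !seriesEnat /= -sumrB.
rewrite (eq_bigr (fun k => if k == m then w x k - w y k else 0)); last first.
  move=> k _; case: ltngtP => // [km|mk].
    by rewrite /w; have [-> ->] := cd0 k km; rewrite !mul0r subrr.
  (* For [k > m] the arguments differ by [b^(k-m-1)] full periods, a natural number written through
     the absolute value of [b]. *)
  suff per : b%:~R ^+ k * pi * val x =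
      b%:~R ^+ k * pi * val y + (pi *+ 2) *+ (`|b|%N ^ (k - m.+1)) :> R.
    rewrite /w /cos_coef /sin_coef per.
    by rewrite (periodicn (@cosD2pi R)) (periodicn (@sinD2pi R)) subrr.
  have bE : b%:~R = `|b|%N%:R :> R.
    by rewrite -{1}(gez0_abs (ltW (lt_trans ltr01 b1))).
  have bN0 : b%:~R != 0 :> R by rewrite intr_eq0 gt_eqF// (lt_trans ltr01).
  rewrite xy mulrDr; congr (_ + _); rewrite -[RHS]mulr_natr natrX -bE.
  rewrite -{1}(subnK mk) exprD; field.
  by rewrite expf_neq0.
by rewrite -big_mkcond big_nat1_eq mn.
Qed.

(* Evaluation at [x, y = +- 1 / b^(m+1)] isolates [d m], and at
   [x, y = 1 / (2 b^m) +- 1 / b^(m+1)] it isolates [c m]. *)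
Lemma has_expansion0_coef0 c d : has_expansion a b 0 c d ->
  forall m, c m = 0 /\ d m = 0.
Proof.
move=> E m; elim/ltn_ind: m => m IH.
pose B : R := b%:~R.
have B2 : 2 <= B by rewrite /B -[2]/(2%:~R) ler_int.
have B0 : B != 0 by rewrite gt_eqF//; lra.
pose q := (B ^+ m.+1)^-1; pose r := (B ^+ m)^-1.
have Bm1 : 1 <= B ^+ m by rewrite exprn_ege1//; lra.
have q0 : 0 < q by rewrite invr_gt0 exprn_gt0//; lra.
have rq : r = B * q by rewrite /r /q exprS; field; rewrite expf_neq0 ?B0.
have r1 : r <= 1 by rewrite invf_le1//; lra.
(* This is [b >= 2]; with [r <= 1] it keeps all four points in [-1, 1]. *)
have r2 : 2 * q <= r by rewrite rq ler_pM2r.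
have itv t : -1 <= t <= 1 -> exists x : sym_itv R, val x = t.
  by move=> ht; exists (exist _ t ht).
have [x1 x1E] := itv q ltac:(lra).
have [y1 y1E] := itv (- q) ltac:(lra).
have [x2 x2E] := itv (r / 2 + q) ltac:(lra).
have [y2 y2E] := itv (r / 2 - q) ltac:(lra).
have q2 : 2 / b%:~R ^+ m.+1 = 2 * q by [].
have := @has_expansion0_term_eq c d m x1 y1 E IH.
have := @has_expansion0_term_eq c d m x2 y2 E IH.
rewrite x1E y1E x2E y2E q2 /cos_coef /sin_coef x1E y1E x2E y2E -/B.
pose th := pi / B : R.
have e1 : B ^+ m * pi * q = th.
  by rewrite /q /th exprS; field; rewrite expf_neq0 B0.
have e2 : B ^+ m * pi * (r / 2) = pi / 2.
  by rewrite /r; field; rewrite expf_neq0.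
have e3 : B ^+ m * pi * - q = - th by rewrite [LHS]mulrN e1.
have e4 : B ^+ m * pi * (r / 2 + q) = th + pi / 2.
  by rewrite [LHS]mulrDr e1 e2 addrC.
have e5 : B ^+ m * pi * (r / 2 - q) = - th + pi / 2.
  by rewrite [LHS]mulrDr e3 e2 addrC.
rewrite e1 e3 e4 e5 !cosDpihalf !sinDpihalf cosN !sinN.
have aN0 : a `^ (m%:R / 2) != 0 by rewrite gt_eqF// powR_gt0.
(* The angle [pi / b] lies strictly between 0 and [pi]. *)
have sth : sin th != 0.
  rewrite gt_eqF// sin_gt0_pi// divr_gt0 ?pi_gt0//=; last lra.
  by rewrite ltr_pdivrMr ?ltr_pMr ?pi_gt0//; lra.
set A := a `^ _ in aN0 *.
move=> /(_ ltac:(lra)) h2 /(_ ltac:(lra)) h1.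
have ce : c m * (A * sin th) = 0 by lra.
have de : d m * (A * sin th) = 0 by lra.
have As : A * sin th != 0 by rewrite mulf_neq0.
by split; apply/eqP; [move/eqP: ce|move/eqP: de];
  rewrite mulf_eq0 (negbTE As) orbF.
Qed.

Lemma has_expansion_unique f c d e h :
  has_expansion a b f c d -> has_expansion a b f e h -> c = e /\ d = h.
Proof.
move=> cd eh; have := has_expansionB cd eh.
rewrite subrr => /has_expansion0_coef0 E.
by split; apply/funext => n; have [/eqP + /eqP] := E n;
  rewrite !subr_eq0 => /eqP + /eqP.
Qed.

End WeierstrassExpansions.
Arguments cos_coef {R} a b x _.
Arguments sin_coef {R} a b x _.

(** * Hilbert structure and reproducing property of the Weierstrass space *)

Section WeierstrassSpace.
Context {R : realType} {a : R} {b : int}.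
Hypotheses (a0 : 0 < a) (a1 : a < 1) (b1 : 1 < b).
Implicit Types (f g : sym_itv R -> R) (c d e h : R^nat).

(** A choice of coefficients, forced on the space by uniqueness; outside it the default is the zero
    pair. *)
Definition weierstrass_coefs f : R^nat * R^nat :=
  xget (0, 0) [set p | has_expansion a b f p.1 p.2].

Definition weierstrass_ip f g : R :=
  let p := weierstrass_coefs f in let q := weierstrass_coefs g in
  limn (series (fun n => p.1 n * q.1 n + p.2 n * q.2 n)).

Lemma weierstrass_coefsE f c d : has_expansion a b f c d ->
  weierstrass_coefs f = (c, d).
Proof.
move=> E; apply: xget_unique => //= -[e h] /= E'.
by have [-> ->] := has_expansion_unique a0 b1 E E'.
Qed.

Lemma weierstrass_ip_cvg : is_weierstrass_ip a b weierstrass_ip.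
Proof.
move=> f g c d e h fE gE.
rewrite /weierstrass_ip (weierstrass_coefsE fE) (weierstrass_coefsE gE) /=.
by case: fE gE => [c2 d2 _] [e2 h2 _]; exact: cvg_series_mul2.
Qed.

Lemma weierstrass_ip_unique f g c d e h (l : R) :
  has_expansion a b f c d -> has_expansion a b g e h ->
  series (fun n => c n * e n + d n * h n) @ \oo --> l ->
  weierstrass_ip f g = l.
Proof.
by move=> fE gE; apply: cvg_unique => //; exact: (weierstrass_ip_cvg fE gE).
Qed.

(** With the converse bound [weierstrass_ip_sq_le], this translates norms into the partial-sum
    estimates of [square_summable_complete]. *)
Lemma weierstrass_ip_sq_ge f c d n : has_expansion a b f c d ->
  series (fun k => c k ^+ 2) n + series (fun k => d k ^+ 2) n
    <= weierstrass_ip f f.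
Proof.
move=> E; have fE := weierstrass_ip_cvg E E.
apply: le_trans (series_ge0_le_lim n _ fE).
  by rewrite !seriesEnat /= -big_split; apply: ler_sum => k _; rewrite !expr2.
by move=> k; rewrite -!expr2 addr_ge0// sqr_ge0.
Qed.

Lemma weierstrass_ip_sq_le f c d (M : R) : has_expansion a b f c d ->
  (forall n,
     series (fun k => c k ^+ 2) n + series (fun k => d k ^+ 2) n <= M) ->
  weierstrass_ip f f <= M.
Proof.
move=> E cdM; apply: (cvgr_to_le (weierstrass_ip_cvg E E)); near=> n.
apply: le_trans (cdM n).
by rewrite !seriesEnat /= -big_split; apply: ler_sum => k _; rewrite !expr2.
Unshelve. all: by end_near. Qed.

Lemma series_sqr_ge0 (c : R^nat) n : 0 <= series (fun k => c k ^+ 2) n.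
Proof. by rewrite seriesEnat /=; apply: sumr_ge0 => k _; exact: sqr_ge0. Qed.

Lemma weierstrass_ip_inner_product :
  is_inner_product (weierstrass_space a b) weierstrass_ip.
Proof.
split=> [f g|k f g w|f|f].
- move=> [c [d fE]] [e [h gE]]; apply: (weierstrass_ip_unique fE gE).
  have := weierstrass_ip_cvg gE fE.
  by under eq_fun => n do rewrite mulrC [h n * _]mulrC.
- move=> [c [d fE]] [e [h gE]] [s [t wE]].
  apply: (weierstrass_ip_unique (has_expansion_lin k fE gE) wE).
  have := cvg_series_lin (k := k) (weierstrass_ip_cvg fE wE)
    (weierstrass_ip_cvg gE wE).
  rewrite (_ : (fun n => k * _ + _) = fun n => (k * c n + e n) * s n +
    (k * d n + h n) * t n)//.
  by apply/funext => n; ring.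
- move=> [c [d fE]]; have := weierstrass_ip_sq_ge 0 fE.
  by apply: le_trans; rewrite addr_ge0 ?series_sqr_ge0.
- move=> [c [d fE]] f0.
  have cd0 n : c n = 0 /\ d n = 0.
    (* Partial sums up to [n.+1] have the squares of index [n] as last terms. *)
    have := weierstrass_ip_sq_ge n.+1 fE; rewrite f0.
    have := series_sqr_ge0 c n; have := series_sqr_ge0 d n.
    rewrite !seriesEnat /= !big_nat_recr//= => d0 c0 cd.
    have := sqr_ge0 (c n); have := sqr_ge0 (d n) => dn cn.
    by split; apply/eqP; rewrite -sqrf_eq0; apply/eqP; lra.
  have cE : c = fun=> 0 by apply/funext => n; have [] := cd0 n.
  have dE : d = fun=> 0 by apply/funext => n; have [] := cd0 n.
  rewrite cE dE in fE; apply/funext => x; have [_ _ /(_ x) fx] := fE.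
  by have [_ _ /(_ x)] := @has_expansion0 R a b; exact: cvg_unique fx.
Qed.

Lemma weierstrass_complete : ip_complete (weierstrass_space a b) weierstrass_ip.
Proof.
move=> u uH uC.
have /choice[p pE] : forall n, exists p : R^nat * R^nat,
    has_expansion a b (u n) p.1 p.2.
  by move=> n; have [c [d E]] := uH n; exists (c, d).
have pC (e : R) : 0 < e -> exists N, forall m n,
    (N <= m)%N -> (N <= n)%N -> forall K,
    series (fun k => ((p m).1 k - (p n).1 k) ^+ 2) K +
    series (fun k => ((p m).2 k - (p n).2 k) ^+ 2) K <= e.
  move=> e0; have [|N NP] := uC (Num.sqrt e); first by rewrite sqrtr_gt0.
  exists N => m n Nm Nn K; have := NP m n Nm Nn.
  rewrite /ip_norm ltr_sqrt// => /ltW; apply: le_trans.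
  exact: (weierstrass_ip_sq_ge _ (has_expansionB (pE m) (pE n))).
have [|s sP] := @square_summable_complete _ (fun n => (p n).1).
  move=> e /pC[N NP]; exists N => m n Nm Nn K.
  by apply: le_trans (NP m n Nm Nn K); rewrite lerDl series_sqr_ge0.
have [|t tP] := @square_summable_complete _ (fun n => (p n).2).
  move=> e /pC[N NP]; exists N => m n Nm Nn K.
  by apply: le_trans (NP m n Nm Nn K); rewrite lerDr series_sqr_ge0.
(* The limit is [v N] minus [v N - w], both square-summable. *)
have summable_lim (v : nat -> R^nat) (w : R^nat) :
    (forall n, square_summable (v n)) ->
    (forall e : R, 0 < e -> exists N, forall m, (N <= m)%N -> forall K,
       series (fun k => (v m k - w k) ^+ 2) K <= e) -> square_summable w.
  move=> v2 /(_ 1 ltr01)[N /(_ N (leqnn N)) vw].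
  have := square_summable_lin (k := -1) (square_summable_bounded vw) (v2 N).
  by under eq_fun => n do rewrite mulN1r opprB subrK.
have [||f fE] := @has_expansion_ex _ a b a0 a1 s t.
- by apply: summable_lim sP => n; case: (pE n).
- by apply: summable_lim tP => n; case: (pE n).
exists f; first by exists s, t.
apply/cvgrPdist_lt => e e0.
(* Two thirds of [e^2], one for each coefficient sequence, leave a strict inequality. *)
have e3 : 0 < e ^+ 2 / 3 by rewrite divr_gt0 ?exprn_gt0.
have [N1 N1P] := sP _ e3; have [N2 N2P] := tP _ e3.
exists (maxn N1 N2) => // n /=; rewrite geq_max => /andP[n1 n2].
rewrite sub0r normrN ger0_norm ?sqrtr_ge0//.
rewrite -(ger0_norm (ltW e0)) -sqrtr_sqr ltr_sqrt ?exprn_gt0//.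
have uf : weierstrass_ip (u n - f) (u n - f) <= e ^+ 2 / 3 + e ^+ 2 / 3.
  apply: (weierstrass_ip_sq_le (has_expansionB (pE n) fE)) => K.
  by apply: lerD; [exact: N1P|exact: N2P].
apply: le_lt_trans uf _; lra.
Qed.

Lemma weierstrass_hilbert :
  hilbert_function_space (weierstrass_space a b) weierstrass_ip.
Proof.
split.
- by exists (fun=> 0), (fun=> 0); exact: has_expansion0.
- move=> k f g [c [d fE]] [e [h gE]].
  exists (fun n => k * c n + e n), (fun n => k * d n + h n).
  exact: has_expansion_lin.
- exact: weierstrass_ip_inner_product.
- exact: weierstrass_complete.
Qed.

(** Pairing the coefficients of [f] with those of the kernel section at [x] gives the very series
    that sums to [f x]. *)
Lemma weierstrass_reproduces : reproduces (weierstrass_kernel a b)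
  (weierstrass_space a b) weierstrass_ip.
Proof.
split=> [x|f x [c [d fE]]].
  by exists (cos_coef a b x), (sin_coef a b x); exact: has_expansion_kernel.
apply/esym; apply: (weierstrass_ip_unique fE (has_expansion_kernel a0 a1 x)).
by have /has_expansion_series[_ _ /(_ x)] := fE.
Qed.

End WeierstrassSpace.
Arguments weierstrass_ip {R} a b f g.

Theorem theorem3p1 (R : realType) (a : R) (b : int)
    (ha0 : 0 < a) (ha1 : a < 1) (hab : 1 <= a * b%:~R) :
  exists ip : (sym_itv R -> R) -> (sym_itv R -> R) -> R,
    is_weierstrass_ip a b ip /\
    is_rkhs_induced_by (weierstrass_kernel a b) (weierstrass_space a b) ip.
Proof.
(* As [0 < a < 1], the bound [a b >= 1] forces [b > 1], on which uniqueness of coefficients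
   rests. *)
have b1 : 1 < b by rewrite -(ltr_int R); nra.
have hH := weierstrass_hilbert ha0 ha1 b1.
have hW := weierstrass_reproduces ha0 ha1 b1.
exists (weierstrass_ip a b); split; first exact: weierstrass_ip_cvg.
split=> //; first exact: (reproduces_positive_definite hH).
by move=> H' ip' hH' hW'; exact: (rkhs_unique hH hW hH' hW').
Qed.
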